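(* Let $n\ge1$. Let $\kappa: J_n\to A_n$ be the map defined in the context, where $A_n=\{(x_1,\dots,x_n)\in\mathbb{Z}^n : 1\le x_i<2i \text{ for all } i\}$. Then $\kappa$ is a bijection; moreover, for each $(x_1,\dots,x_n)\in A_n$ there is exactly one path in $O_n$ whose sequence of $x$-coordinates of its $(0,1)$-steps is $(x_1-1,x_2-2,\dots,x_n-n)$, and sending $(x_1,\dots,x_n)$ to this path defines a bijection $A_n\to O_n$. Consequently the composite $J_n\to A_n\to O_n$ is a bijection between Brauer diagrams of degree $n$ and overhang paths ending at $(n,n)$.
   Context: $J_n$ is the set of Brauer diagrams of degree $n$, i.e. pair partitions of $2n$ vertices arranged from left to right on a line ($J_0$ has one element). Definition of $\kappa$: given $D\in J_n$, delete the rightmost vertex; its partner becomes a singleton among the remaining $2n-1$ vertices; let $x_n\in\{1,\dots,2n-1\}$ be the position (counted from the left) of this singleton, and delete the singleton to obtain a diagram in $J_{n-1}$. Repeating the procedure with this diagram gives $x_{n-1}$, and so on; $\kappa(D)=(x_1,\dots,x_n)$. $O_n$: here an overhang path is a walk on $\mathbb{Z}\times\mathbb{Z}$ starting at $(0,0)$, using steps $(1,0)$, $(0,1)$, $(-1,0)$, all of whose vertices $(x,y)$ satisfy $y\ge x$ and $y\ge -x$, and visiting no vertex more than once. $O_n$ is the set of such walks ending at $(n,n)$. The $x$-coordinate of a $(0,1)$-step from $(x,y)$ to $(x,y+1)$ is $x$; the $(0,1)$-steps are listed in the order in which they occur. *)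

(* Defs.v *)
From mathcomp Require Import all_boot all_order all_algebra.
From mathcomp Require Import boolp classical_sets functions.

Set Implicit Arguments.
Unset Strict Implicit.
Unset Printing Implicit Defensive.

Import Order.TTheory GRing.Theory Num.Theory.
Local Open Scope ring_scope.

Definition brauer (n : nat) : set {set {set 'I_n.*2}} :=
  [set D | finset.partition D [set: 'I_n.*2]%SET
           /\ (forall B, B \in D -> #|B| = 2%N)]%classic.

(* [lift v] enumerates the vertices other than [v] from left to right, so
   taking preimages under it removes [v] and relabels the remaining vertices;
   the empty set is what is left of the block [[set v]] if it was there. *)
Definition del_vertex (m : nat) (v : 'I_m.+1) (P : {set {set 'I_m.+1}}) :
    {set {set 'I_m}} :=
  ([set lift v @^-1: B | B : {set 'I_m.+1} in P] :\ finset.set0)%SET.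

(* The value [ord0] is only taken when there is no singleton block. *)
Definition singleton_vertex (m : nat) (P : {set {set 'I_m.+1}}) : 'I_m.+1 :=
  odflt ord0 [pick v | [set v]%SET \in P].

(* Vertices are numbered from 0 in ['I_m] but positions are counted from 1. *)
Fixpoint kappa (n : nat) : {set {set 'I_n.*2}} -> n.-tuple int :=
  match n with
  | 0 => fun _ => [tuple]
  | m.+1 => fun D : {set {set 'I_m.*2.+2}} =>
      let D1 := del_vertex ord_max D in
      let s := singleton_vertex D1 in
      [tuple of rcons (kappa (del_vertex s D1)) (s.+1)%:Z]
  end.

(* [tnth x i] is the coordinate of index [i + 1]. *)
Definition kappa_box (n : nat) : set (n.-tuple int) :=
  [set x | forall i : 'I_n, 1 <= tnth x i < 2 * (i.+1)%:Z]%classic.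

Arguments brauer : clear implicits.
Arguments kappa_box : clear implicits.

Definition origin : int * int := (0, 0).

Definition overhang_step : rel (int * int) :=
  fun u v => v - u \in [:: (1, 0); (0, 1); (-1, 0)].

Definition in_wedge (u : int * int) : bool := (u.1 <= u.2) && (- u.1 <= u.2).

(* A walk is represented by the sequence [w] of its vertices after the
   origin, as for the library predicate [path]. *)
Definition overhang (n : nat) : set (seq (int * int)) :=
  [set w | [/\ path overhang_step origin w,
               all in_wedge (origin :: w),
               uniq (origin :: w)
             & last origin w = (n%:Z, n%:Z)]]%classic.

Arguments overhang : clear implicits.

Definition up_xcoords (w : seq (int * int)) : seq int :=
  [seq uv.1.1 | uv <- zip (origin :: w) w & uv.2 - uv.1 == (0, 1)].

Definition overhang_with (n : nat) (x : n.-tuple int) :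
    set (seq (int * int)) :=
  [set w | overhang n w
           /\ up_xcoords w = [seq tnth x i - (i.+1)%:Z | i <- enum 'I_n]]%classic.

(* The element of [overhang_with x]; the default [[::]] is irrelevant when
   that set is nonempty. *)
Definition overhang_of (n : nat) (x : n.-tuple int) : seq (int * int) :=
  xget [::] (overhang_with x).

(* Main.v *)
Require Import Defs.
From mathcomp Require Import all_boot all_order all_algebra.
From mathcomp Require Import boolp classical_sets functions.
(* [finset] comes last so that [set0], [setP], ... refer to finite sets. *)
From mathcomp Require Import zify finset.

(* One round of [kappa] is undone by inserting a new last vertex together with
   its partner at any of the 2n - 1 positions, so kappa is a bijection by
   induction on n.  For the walks, the i-th up step starts at height i - 1, so
   the wedge condition on its start is exactly the i-th box condition.  Within a
   row a self-avoiding walk is monotone, hence determined by where it enters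
   and leaves the row; this gives both existence and uniqueness. *)

Set Implicit Arguments.
Unset Strict Implicit.
Unset Printing Implicit Defensive.

Import Order.TTheory GRing.Theory Num.Theory.
Local Open Scope ring_scope.

(** * Perfect matchings and the insertion of an arc *)

(** Over an arbitrary finite type, so that arcs can be inserted into 'I_m for any m; at 'I_n.*2 it
    is [brauer n] by conversion. *)
Definition perfect_matching (T : finType) (D : {set {set T}}) : Prop :=
  partition D [set: T] /\ (forall B, B \in D -> #|B| = 2%N).

Lemma perfect_matchingP (T : finType) (D : {set {set T}}) :
  perfect_matching D <->
  [/\ forall B, B \in D -> #|B| = 2%N,
      forall x, exists2 B, B \in D & x \in B &
      forall A B x, A \in D -> B \in D -> x \in A -> x \in B -> A = B].
Proof.
split=> [[/and3P[/eqP cD /trivIsetP tD _] c2]|[c2 cov inj]].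
  split=> // [x|A B x AD BD xA xB].
    by apply/bigcupP; rewrite -/(cover D) cD inE.
  apply/eqP/negP=> /negP /(tD _ _ AD BD) /pred0P /(_ x) /=.
  by rewrite xA xB.
split=> //; apply/and3P; split.
- apply/eqP/setP=> x; rewrite inE; apply/bigcupP; exact: cov.
- apply/trivIsetP=> A B AD BD /eqP AB; apply/pred0P=> x /=.
  by apply/negP=> /andP[xA xB]; apply: AB; apply: inj xA xB.
- by apply/negP=> /c2; rewrite cards0.
Qed.

Lemma perfect_matching_set0 (T : finType) (D : {set {set T}}) :
  perfect_matching D -> set0 \notin D.
Proof. by case=> _ c2; apply/negP=> /c2; rewrite cards0. Qed.

(* Undoes one round of [kappa]: [s] becomes the partner of the new last vertex. *)
Definition insert_arc (m : nat) (s : 'I_m.+1) (D : {set {set 'I_m}}) :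
    {set {set 'I_m.+2}} :=
  lift ord_max s |: [set ord_max] |:
    [set lift ord_max @: (lift s @: B : {set 'I_m.+1}) | B : {set 'I_m} in D].

Lemma lift_preimset_imset (m : nat) (v : 'I_m.+1) (B : {set 'I_m}) :
  lift v @^-1: (lift v @: B) = B.
Proof. by apply/setP=> i; rewrite inE mem_imset //; apply: lift_inj. Qed.

(** Preimages under [lift v] undo images, so only the extra block [A] changes; it vanishes if it
    lies inside [set v]. *)
Lemma del_vertexU (m : nat) (v : 'I_m.+1) (A : {set 'I_m.+1})
    (P : {set {set 'I_m}}) : set0 \notin P ->
  del_vertex v (A |: [set lift v @: B | B : {set 'I_m} in P]) =
  (lift v @^-1: A |: P) :\ set0.
Proof.
move=> P0; rewrite /del_vertex imsetU1 -imset_comp; congr (_ :\ _); congr (_ |: _).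
rewrite -[RHS]imset_id; apply: eq_imset => B /=; exact: lift_preimset_imset.
Qed.

Section InsertArc.
Variables (m : nat) (s : 'I_m.+1).
(** Enumerates from left to right the vertices that are not ends of the new arc. *)
Let f (i : 'I_m) : 'I_m.+2 := lift ord_max (lift s i).

Let f_inj : injective f.
Proof. by move=> i j /lift_inj /lift_inj. Qed.

Let f_neq_max i : f i != ord_max.
Proof. by rewrite eq_sym neq_lift. Qed.

Let f_neq_s i : f i != lift ord_max s.
Proof. by rewrite (inj_eq lift_inj) eq_sym neq_lift. Qed.

Let fP x : x \notin [set lift ord_max s; ord_max] -> exists i, x = f i.
Proof.
rewrite !inE negb_or => /andP[xs xm].
case: (unliftP ord_max x) xs xm => [y|] ->; last by rewrite eqxx.
rewrite (inj_eq lift_inj); case: (unliftP s y) => [i|] -> //; last by rewrite eqxx.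
by exists i.
Qed.

Lemma insert_arcE D : insert_arc s D =
  lift ord_max s |: [set ord_max] |: [set f @: B | B : {set 'I_m} in D].
Proof.
by congr (_ |: _); apply: eq_imset => B; rewrite -imset_comp.
Qed.

Let f_notin i : f i \in [set lift ord_max s; ord_max] = false.
Proof. by rewrite !inE (negPf (f_neq_max i)) (negPf (f_neq_s i)). Qed.

Lemma insert_arc_matching D :
  perfect_matching D -> perfect_matching (insert_arc s D).
Proof.
case/perfect_matchingP=> c2 cov inj; apply/perfect_matchingP; rewrite insert_arcE.
split=> [B|x|A B x].
- rewrite in_setU1 => /predU1P[->|/imsetP[C CD ->]].
    by rewrite cards2 eq_sym neq_lift.
  by rewrite card_imset ?c2.
- have [h|/fP[i ->]] := boolP (x \in [set lift ord_max s; ord_max]).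
    by exists [set lift ord_max s; ord_max]; rewrite // in_setU1 eqxx.
  have [B BD iB] := cov i; exists (f @: B); last by rewrite mem_imset.
  by rewrite in_setU1; apply/orP; right; apply: imset_f.
rewrite !in_setU1 => /predU1P[->|/imsetP[A' AD ->]] /predU1P[->|/imsetP[B' BD ->]] //.
- by move=> + /imsetP[i _ xi]; rewrite xi f_notin.
- by move=> /imsetP[i _ xi]; rewrite xi f_notin.
- move=> /imsetP[i iA ->]; rewrite mem_imset // => iB.
  by rewrite (inj _ _ _ AD BD iA iB).
Qed.

(** The new arc is the only block containing the last vertex; losing it, the arc shrinks to the
    singleton of its partner. *)
Lemma del_vertex_insert_arc D : perfect_matching D ->
  del_vertex ord_max (insert_arc s D) =
  [set s] |: [set lift s @: B | B : {set 'I_m} in D].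
Proof.
move=> /perfect_matching_set0 D0; set P := [set lift s @: B | B : {set 'I_m} in D].
have P0 : set0 \notin P.
  apply/imsetP=> -[B BD /esym/eqP]; rewrite imset_eq0 => /eqP B0.
  by rewrite -B0 BD in D0.
rewrite /insert_arc (_ : [set _ | _ in D] = [set lift ord_max @: B | B : {set 'I_m.+1} in P]);
  last by rewrite -imset_comp.
rewrite del_vertexU // (_ : _ @^-1: _ = [set s]).
  apply/setP=> B; rewrite !inE; case: eqP => //= ->.
  rewrite (negPf P0) orbF; apply/esym/negbTE/negP=> /eqP/setP/(_ s).
  by rewrite !inE eqxx.
apply/setP=> i; rewrite !inE (inj_eq lift_inj).
by rewrite [X in _ || X]eq_sym (negPf (neq_lift _ _)) orbF.
Qed.

(** All the other blocks have two elements, so [pick] can only return [s]. *)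
Lemma singleton_vertex_insert_arc D : perfect_matching D ->
  singleton_vertex (del_vertex ord_max (insert_arc s D)) = s.
Proof.
move=> mD; rewrite del_vertex_insert_arc // /singleton_vertex.
case: pickP => [v|/(_ s)] /=; last by rewrite !inE eqxx.
rewrite in_setU1 => /predU1P[/set1_inj //|/imsetP[B BD]] /(congr1 (fun A => #|pred_of_set A|)).
by rewrite cards1 card_imset ?mD.2 //; apply: lift_inj.
Qed.

(** Deleting [s] empties its block, and [del_vertex] discards the empty set, which is not a block of
    [D]. *)
Lemma del_singleton_insert_arc D : perfect_matching D ->
  del_vertex s (del_vertex ord_max (insert_arc s D)) = D.
Proof.
move=> mD; have D0 := perfect_matching_set0 mD.
rewrite del_vertex_insert_arc // del_vertexU // (_ : _ @^-1: _ = set0).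
  apply/setP=> B; rewrite !inE; case: eqP => //= ->; exact/esym/negbTE.
by apply/setP=> i; rewrite !inE eq_sym (negPf (neq_lift _ _)).
Qed.

(** The required matching consists of the preimages under [f] of all blocks other than the arc. *)
Lemma matching_insert_arc D : perfect_matching D ->
  [set lift ord_max s; ord_max] \in D ->
  exists2 D', perfect_matching D' & D = insert_arc s D'.
Proof.
case/perfect_matchingP; set E := [set _; _] => c2 cov inj ED.
(* Any other block is disjoint from the arc, hence lies in the image of [f] and is recovered from
   its preimage. *)
have BE B : B \in D -> B != E -> f @: (f @^-1: B) = B.
  move=> BD /eqP BnE; apply/setP=> x; apply/imsetP/idP => [[i]|xB].
    by rewrite inE => fB ->.
  have [i xi] : exists i, x = f i.
    by apply: fP; apply/negP=> xE; apply: BnE; apply: inj xB xE.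
  by exists i; rewrite // inE -xi.
have neE i (B : {set _}) : f i \in B -> B != E.
  by apply: contraTneq => ->; rewrite f_notin.
exists [set f @^-1: B | B : {set 'I_m.+2} in D :\ E].
  apply/perfect_matchingP; split=> [B|i|A B i].
  - case/imsetP=> C /setD1P[CE CD] ->.
    by rewrite -(card_imset _ f_inj) BE ?c2.
  - have [B BD fB] := cov (f i); exists (f @^-1: B); last by rewrite inE.
    by apply: imset_f; rewrite !inE (neE _ _ fB).
  - case/imsetP=> A' /setD1P[_ AD] -> /imsetP[B' /setD1P[_ BD] ->].
    by rewrite !inE => fA fB; rewrite (inj _ _ _ AD BD fA fB).
rewrite insert_arcE -imset_comp -[LHS](setD1K ED); congr (_ |: _).
rewrite -[LHS]imset_id; apply: eq_in_imset => B /setD1P[BnE BD] /=.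
by rewrite BE.
Qed.

End InsertArc.

Lemma matching_insert_arcP (m : nat) (D : {set {set 'I_m.+2}}) :
  perfect_matching D ->
  exists s D', perfect_matching D' /\ D = insert_arc s D'.
Proof.
move=> mD; case/perfect_matchingP: (mD) => c2 cov _.
have [B BD mB] := cov ord_max.
(* [b] is the partner of the last vertex, and [s] will be its position among the other vertices. *)
have /cards1P[b Bb] : #|B :\ ord_max| == 1%N.
  by move: (cardsD1 ord_max B); rewrite mB (c2 _ BD) // add1n => -[<-].
have bm : ord_max != b by have := set11 b; rewrite -Bb eq_sym => /setD1P[].
case/unlift_some: bm => s bs _; exists s.
have [|D' mD' ->] := @matching_insert_arc _ s D mD; last by exists D'.
by rewrite -bs setUC -Bb setD1K.
Qed.

(** * Bijectivity of [kappa] *)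

Lemma kappa_insert_arc (n : nat) (s : 'I_n.*2.+1) (D : {set {set 'I_n.*2}}) :
  perfect_matching D ->
  @kappa n.+1 (insert_arc s D) = [tuple of rcons (kappa D) (s.+1)%:Z].
Proof.
move=> mD /=; apply: val_inj => /=.
by rewrite singleton_vertex_insert_arc // del_singleton_insert_arc.
Qed.

Lemma kappa_box_rcons (n : nat) (x : n.-tuple int) (a : int) :
  kappa_box n.+1 [tuple of rcons x a] <->
  kappa_box n x /\ 1 <= a < 2 * (n.+1)%:Z.
Proof.
have E i : tnth [tuple of rcons x a] i = nth 0 (rcons x a) i by rewrite (tnth_nth 0).
have Ex i : tnth x i = nth 0 x i by rewrite (tnth_nth 0).
split=> [h|[hx ha] i].
  split=> [i|].
    have := h (widen_ord (leqnSn n) i).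
    by rewrite E Ex nth_rcons size_tuple /= ltn_ord.
  have := h ord_max; by rewrite E nth_rcons size_tuple /= ltnn eqxx.
rewrite E nth_rcons size_tuple.
have [lti|lein] := ltnP i n; first by have := hx (Ordinal lti); rewrite Ex.
have -> : i = n :> nat by apply/eqP; rewrite eqn_leq lein -ltnS ltn_ord.
by rewrite eqxx.
Qed.

Lemma kappa_set_bij (n : nat) : set_bij (brauer n) (kappa_box n) (@kappa n).
Proof.
elim: n => [|n [funn injn surjn]].
  split=> [D _ [i //]|D D'|x _].
    move=> /set_mem[pD _] /set_mem[pD' _] _.
    have T0 : [set: 'I_0] = set0 by apply/setP=> -[].
    move: pD pD'; rewrite /= T0 !partition_set0.
    by move=> /eqP -> /eqP ->.
  exists set0; last by rewrite [RHS]tuple0.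
  split=> [|B]; last by rewrite inE.
  by rewrite (_ : [set: _] = set0) ?partition_set0 //; apply/setP=> -[].
split.
- move=> D /matching_insert_arcP[s [D' [mD' ->]]].
  rewrite kappa_insert_arc //; apply/kappa_box_rcons; split; first exact: funn.
  have := ltn_ord s; move: (nat_of_ord s) => k; rewrite -/(n.*2); lia.
- move=> D1 D2 /set_mem/matching_insert_arcP[s [D [mD ->]]].
  move=> /set_mem/matching_insert_arcP[s' [D' [mD' ->]]].
  rewrite !kappa_insert_arc // => /(congr1 val) /= /rcons_inj[] /val_inj kD ss'.
  have -> : s = s' by apply: val_inj; case: ss'.
  by rewrite (injn D D' (mem_set mD) (mem_set mD') kD).
- case=> t; case/lastP: t => // t a sz.
  have szt : size t == n by move: sz; rewrite size_rcons eqSS.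
  rewrite (_ : Tuple sz = [tuple of rcons (Tuple szt) a]); last exact: val_inj.
  case/kappa_box_rcons=> /surjn[D mD kD] ha.
  (* The coordinate [a] counts positions from 1, while ordinals count from 0. *)
  have lta : (`|a - 1| < n.*2.+1)%N by lia.
  exists (insert_arc (Ordinal lta) D); first exact: insert_arc_matching.
  rewrite kappa_insert_arc // kD; apply: val_inj => /=.
  by congr rcons; lia.
Qed.

(** * Heights and up steps along a walk *)

Implicit Types (u v : int * int) (w : seq (int * int)) (cs : seq int).

(** The start is arbitrary to allow induction along the walk; at [origin] this is [up_xcoords]. *)
Definition up_xcoords_from u w : seq int :=
  [seq uv.1.1 | uv <- zip (u :: w) w & uv.2 - uv.1 == (0, 1)].

(** Left and right steps share one case with a sign [s], so that arguments by symmetry are made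
    once. *)
Variant overhang_step_spec u v : Prop :=
| UpStep of v = (u.1, u.2 + 1)
| SideStep s of s = 1 \/ s = -1 & v = (u.1 + s, u.2).

Lemma overhang_stepP u v : overhang_step u v <-> overhang_step_spec u v.
Proof.
case: u v => [a b] [c d]; rewrite /overhang_step !inE !xpair_eqE /=.
split=> [|[[-> ->]|s [] -> [-> ->]]]; last 3 first; try by lia.
case/or3P=> /andP[/eqP h1 /eqP h2].
- by apply: (@SideStep _ _ 1); [left | congr pair => /=; lia].
- by apply: UpStep; congr pair => /=; lia.
- by apply: (@SideStep _ _ (-1)); [right | congr pair => /=; lia].
Qed.

Lemma up_xcoords_from_up a y w :
  up_xcoords_from (a, y) ((a, y + 1) :: w) = a :: up_xcoords_from (a, y + 1) w.
Proof.
rewrite /up_xcoords_from /= ifT //; rewrite xpair_eqE /=; lia.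
Qed.

Lemma up_xcoords_from_side a y s w : s = 1 \/ s = -1 ->
  up_xcoords_from (a, y) ((a + s, y) :: w) = up_xcoords_from (a + s, y) w.
Proof.
move=> hs; rewrite /up_xcoords_from /= ifF //; rewrite xpair_eqE /=; lia.
Qed.

Lemma overhang_path_height u w v :
  path overhang_step u w -> v \in w -> u.2 <= v.2.
Proof.
elim: w u => [|z w IHw] [a b] //= /andP[/overhang_stepP st pw].
rewrite inE => /predU1P[->|/(IHw _ pw)].
  by case: st => [->|s _ ->] /=; lia.
by case: st => [->|s _ ->] /=; lia.
Qed.

(** Only up steps change the height, each by one; so a walk from the origin to (n, n) has exactly n
    of them. *)
Lemma last_height u w : path overhang_step u w ->
  (last u w).2 = u.2 + (size (up_xcoords_from u w))%:Z.
Proof.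
elim: w u => [|z w IHw] [a b] /=; first by lia.
case/andP=> /overhang_stepP[->|s hs ->] /IHw -> /=.
  by rewrite up_xcoords_from_up /=; lia.
by rewrite up_xcoords_from_side.
Qed.

(** Counting from 0, up step [i] is preceded by [i] up steps, which fixes the height at which it
    starts. *)
Lemma up_xcoords_from_mem u w i : path overhang_step u w ->
  (i < size (up_xcoords_from u w))%N ->
  (nth 0 (up_xcoords_from u w) i, u.2 + i%:Z) \in u :: w.
Proof.
elim: w u i => [|z w IHw] [a b] i //=.
case/andP=> /overhang_stepP[->|s hs ->] pw /=.
  rewrite up_xcoords_from_up; case: i => [|i] /= lti.
    by rewrite addr0 mem_head.
  rewrite inE; apply/orP; right.
  rewrite (_ : b + i.+1%:Z = b + 1 + i%:Z); last by lia.
  exact: (IHw _ i pw lti).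
rewrite up_xcoords_from_side // => lti.
by rewrite inE; apply/orP; right; apply: (IHw _ i pw lti).
Qed.

(** * Uniqueness of the walk with given up steps *)

(** The abscissa at which the walk leaves the row of [u], or ends if it never leaves that row. *)
Definition next_exit u w : int :=
  head (last u w).1 (up_xcoords_from u w).

(** A self-avoiding walk cannot turn around within a row, so it leaves the row strictly on the side
    of its first step. *)
Lemma next_exit_side u s w : s = 1 \/ s = -1 ->
  let v := (u.1 + s, u.2) in
  path overhang_step v w -> uniq (u :: v :: w) ->
  0 < s * (next_exit v w - u.1).
Proof.
move=> hs /=; elim: w u => [|z w IHw] [a b] /=.
  by rewrite /next_exit /=; lia.
case/andP=> /overhang_stepP[->|t ht ->] /= pw.
  by rewrite /next_exit up_xcoords_from_up /=; lia.
have [e|e] : t = s \/ t = - s by lia.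
  rewrite e in pw *; move/andP=> [_ un]; have /= := IHw (a + s, b) pw un.
  rewrite /next_exit /= up_xcoords_from_side //.
  by move: (head _ _) => h; case: hs => ->; lia.
(* Turning back would revisit [u]. *)
by rewrite e addrK !inE eqxx !orbT.
Qed.

Lemma last_eq_nil u w : uniq (u :: w) -> last u w = u -> w = [::].
Proof.
by case: w => [|v w] //= /andP[+ _] lu; rewrite -[X in X \notin _]lu mem_last.
Qed.

(* The sign of [next_exit u w - u.1] determines the first step of [w]. *)
Lemma overhang_walk_inj u w w' :
  path overhang_step u w -> path overhang_step u w' ->
  uniq (u :: w) -> uniq (u :: w') ->
  last u w = last u w' -> up_xcoords_from u w = up_xcoords_from u w' -> w = w'.
Proof.
elim: w u w' => [|v w IHw] u [|v' w'] // pw pw' un un' lw uw.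
- by rewrite (last_eq_nil un' (esym lw)).
- by rewrite (last_eq_nil un lw).
(* The exit depends only on the end point and the up steps, which the two walks share. *)
have ew : next_exit u (v :: w) = next_exit u (v' :: w').
  by rewrite /next_exit lw uw.
have vv' : v = v'.
  have first_step z x : path overhang_step u (z :: x) ->
      uniq (u :: z :: x) ->
      z = (u.1, u.2 + 1) /\ next_exit u (z :: x) = u.1 \/
      exists s, [/\ s = 1 \/ s = -1, z = (u.1 + s, u.2) &
                   0 < s * (next_exit u (z :: x) - u.1)].
    move=> /= /andP[/overhang_stepP[->|s hs ->] px] ux; [left|right].
      by split=> //; case: (u) => a b; rewrite /next_exit up_xcoords_from_up.
    exists s; split=> //; move: (next_exit_side hs px ux).
    by case: (u) => a b /=; rewrite /next_exit /= up_xcoords_from_side.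
  have [[ev h]|[s [hs ev h]]] := first_step _ _ pw un;
  have [[ev' h']|[s' [hs' ev' h']]] := first_step _ _ pw' un'.
  - by rewrite ev ev'.
  - by move: h'; rewrite -ew h subrr mulr0 ltxx.
  - by move: h; rewrite ew h' subrr mulr0 ltxx.
  rewrite ev ev'; have -> // : s = s'; move: h h'; rewrite ew.
  by case: hs => ->; case: hs' => ->; lia.
rewrite -vv' in pw' un' lw uw *; congr cons.
move: pw pw' un un' => /= /andP[st pw] /andP[_ pw'] /andP[_ un] /andP[_ un'].
apply: (IHw v) => //.
move: uw; case/overhang_stepP: st => [->|s hs ->]; case: (u) => a b.
  by rewrite !up_xcoords_from_up => -[].
by rewrite !up_xcoords_from_side.
Qed.

(** * Existence of a walk with given up steps *)

(** Start, end and up steps are parameters, so that walks can be built backwards by prepending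
    vertices. *)
Definition overhang_walk u cs v w : Prop :=
  [/\ path overhang_step u w, all in_wedge (u :: w), uniq (u :: w),
      last u w = v & up_xcoords_from u w = cs].

(** No step goes down, so the new vertex stays strictly below the rest of the walk and is not
    revisited. *)
Lemma overhang_walk_up a y cs v w : in_wedge (a, y) ->
  overhang_walk (a, y + 1) cs v w ->
  overhang_walk (a, y) (a :: cs) v ((a, y + 1) :: w).
Proof.
move=> wu [pw ww un lw uw]; split.
- by rewrite /= pw andbT; apply/overhang_stepP; apply: UpStep.
- by apply/andP; split.
- rewrite cons_uniq un andbT inE xpair_eqE negb_or; apply/andP; split; first by lia.
  by apply/negP=> /(overhang_path_height pw) /=; lia.
- by [].
- by rewrite up_xcoords_from_up uw.
Qed.

(** Prepends [k] steps in direction [s]. The bound on the vertices in row [y] is the invariant that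
    keeps the walk self-avoiding. *)
Lemma overhang_walk_side s k a y cs v w : s = 1 \/ s = -1 ->
  in_wedge (a, y) -> in_wedge (a + s * k%:Z, y) ->
  (forall z : int * int, z \in w -> y < z.2) ->
  overhang_walk (a + s * k%:Z, y) cs v w ->
  exists2 w', overhang_walk (a, y) cs v w' &
    forall z : int * int, z \in w' -> z.2 = y -> 0 <= s * (z.1 - a).
Proof.
move=> hs + wt hw W; elim: k a wt W => [|k IHk] a wt W wa.
  rewrite mulr0 addr0 in W; exists w => // z /hw; lia.
have e : a + s + s * k%:Z = a + s * k.+1%:Z by lia.
(* Each row of the wedge is an interval, and a + s lies between the two ends of the segment. *)
have wa' : in_wedge (a + s, y).
  by move: wa wt; rewrite /in_wedge /=; case: hs => ->; lia.
have [||w' [pw ww un lw uw] hw'] := IHk (a + s) _ _ wa'; rewrite ?e //.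
exists ((a + s, y) :: w').
  split.
  - by rewrite /= pw andbT; apply/overhang_stepP; apply: (SideStep hs).
  - by apply/andP; split.
  - rewrite cons_uniq un andbT inE xpair_eqE negb_or; apply/andP; split; first by lia.
    by apply/negP=> /hw' /(_ erefl) /=; lia.
  - by [].
  - by rewrite up_xcoords_from_side.
move=> z; rewrite inE => /predU1P[->|/hw' h zy] /=; first by lia.
by have := h zy; case: hs => ->; lia.
Qed.

Lemma overhang_walk_row c a y cs v w :
  in_wedge (a, y) -> in_wedge (c, y) ->
  (forall z : int * int, z \in w -> y < z.2) -> overhang_walk (c, y) cs v w ->
  exists w', overhang_walk (a, y) cs v w'.
Proof.
move=> wa wc hw W.
(* The row is crossed straight from [a] to [c]: [s] is the direction and |c - a| the number of
   steps. *)
have [s hs e] : exists2 s, s = 1 \/ s = -1 & c = a + s * `|c - a|%N%:Z.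
  by have [h|h] := lerP a c; [exists 1|exists (-1)]; lia.
rewrite e in W wc; have [w' W' _] := overhang_walk_side hs wa wc hw W.
by exists w'.
Qed.

(** In each row, go straight to the next prescribed abscissa and step up; the top row is followed to
    the boundary point (r, r). *)
Lemma overhang_walk_exists a y cs : in_wedge (a, y) ->
  (forall i, (i < size cs)%N -> in_wedge (nth 0 cs i, y + i%:Z)) ->
  let r := y + (size cs)%:Z in
  exists w, overhang_walk (a, y) cs (r, r) w.
Proof.
elim: cs a y => [|c cs IHcs] a y wa wcs /=.
  rewrite addr0; apply: (@overhang_walk_row y _ _ _ _ [::]) => //.
    by move: wa; rewrite /in_wedge /=; lia.
  by split=> //=; move: wa; rewrite /in_wedge /=; lia.
have wc : in_wedge (c, y) by have := wcs 0%N isT; rewrite addr0.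
(* The wedge widens upwards, so the up step ends inside it. *)
have [||w] := IHcs c (y + 1); first by move: wc; rewrite /in_wedge /=; lia.
  move=> i lti; have := wcs i.+1 lti; rewrite (_ : y + _ = y + 1 + i%:Z) //; lia.
rewrite (_ : y + 1 + _ = y + (size cs).+1%:Z); last by lia.
move=> W; apply: (overhang_walk_row wa wc _ (overhang_walk_up wc W)).
case: W => pw _ _ _ _ z; rewrite inE => /predU1P[->|/(overhang_path_height pw)] /=; lia.
Qed.

(** * The bijection between the box and the overhang paths *)

Lemma nth_shifted (n : nat) (x : n.-tuple int) i : (i < n)%N ->
  nth 0 [seq tnth x j - (j.+1)%:Z | j <- enum 'I_n] i = nth 0 x i - (i.+1)%:Z.
Proof.
move=> lti; rewrite (nth_map (Ordinal lti)) ?size_enum_ord //.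
by rewrite (tnth_nth 0) !nth_enum_ord.
Qed.

Lemma overhang_with_exists (n : nat) (x : n.-tuple int) :
  kappa_box n x -> exists w, overhang_with x w.
Proof.
move=> hx; set cs := [seq tnth x i - (i.+1)%:Z | i <- enum 'I_n].
have szc : size cs = n by rewrite size_map size_enum_ord.
have [//|i|w] := @overhang_walk_exists 0 0 cs.
  rewrite szc => lti; rewrite nth_shifted //.
  (* Shifting by i + 1 turns 1 <= c < 2(i + 1) into -i <= c - (i + 1) <= i, the wedge condition at
     height i. *)
  have := hx (Ordinal lti); rewrite (tnth_nth 0) /in_wedge /=.
  by move: (nth 0 x i) => c; lia.
by rewrite szc add0r => -[pw ww un lw uw]; exists w; split.
Qed.

Lemma overhang_with_unique (n : nat) (x : n.-tuple int) w w' :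
  overhang_with x w -> overhang_with x w' -> w = w'.
Proof.
move=> [[pw _ un lw] uw] [[pw' _ un' lw'] uw'].
apply: (overhang_walk_inj pw pw' un un'); first by rewrite lw lw'.
exact: etrans uw (esym uw').
Qed.

Lemma overhang_with_inj (n : nat) (x y : n.-tuple int) w :
  overhang_with x w -> overhang_with y w -> x = y.
Proof.
move=> [_ xw] [_ yw]; apply: eq_from_tnth => i.
have := congr1 (nth 0 ^~ i) (etrans (esym xw) yw); rewrite /= !nth_shifted // => /addIr.
by rewrite !(tnth_nth 0).
Qed.

(** Undoing the shift on the up steps of [w] gives the tuple; it lies in the box because every up
    step starts in the wedge. *)
Lemma overhang_with_kappa_box (n : nat) w :
  overhang n w -> exists2 x, kappa_box n x & overhang_with x w.
Proof.
move=> ow; have [pw ww _ lw] := ow; set cs := up_xcoords w.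
have szc : size cs = n.
  by have := last_height pw; rewrite lw /= add0r => -[].
have sz : size (mkseq (fun i => nth 0 cs i + (i.+1)%:Z) n) == n by rewrite size_mkseq.
exists (Tuple sz).
  move=> i; rewrite (tnth_nth 0) /= nth_mkseq //.
  have lti : (i < size (up_xcoords_from origin w))%N by rewrite [size _]szc.
  have /(allP ww) := up_xcoords_from_mem pw lti.
  by rewrite /in_wedge /= -/(up_xcoords w) -/cs; move: (nth 0 cs i) => c; lia.
split=> //; apply: (@eq_from_nth _ 0).
  by rewrite -/cs szc size_map size_enum_ord.
move=> i; rewrite -/cs szc => lti; rewrite nth_shifted //=.
by rewrite nth_mkseq //; lia.
Qed.

Lemma overhang_ofP (n : nat) (x : n.-tuple int) :
  kappa_box n x -> overhang_with x (overhang_of x).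
Proof. by case/overhang_with_exists=> w; apply: xgetI. Qed.

Lemma overhang_of_set_bij (n : nat) :
  set_bij (kappa_box n) (overhang n) (@overhang_of n).
Proof.
split.
- by move=> x /overhang_ofP[].
- move=> x y /set_mem/overhang_ofP xw /set_mem/overhang_ofP yw e.
  by rewrite -e in yw; apply: overhang_with_inj xw yw.
- move=> w /overhang_with_kappa_box[x hx xw]; exists x => //.
  exact: overhang_with_unique (overhang_ofP hx) xw.
Qed.

Theorem mainTheorem2 (n : nat) (hn : (1 <= n)%N) :
  [/\ set_bij (brauer n) (kappa_box n) (@kappa n),
      forall x : n.-tuple int, kappa_box n x ->
        exists! w : seq (int * int), overhang_with x w,
      set_bij (kappa_box n) (overhang n) (@overhang_of n)
    & set_bij (brauer n) (overhang n) (@overhang_of n \o @kappa n)].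
Proof.
have kb := kappa_set_bij n; have ob := overhang_of_set_bij n.
split=> // [x hx|]; last exact: set_bij_comp kb ob.
exists (overhang_of x); split=> [|w]; first exact: overhang_ofP.
exact: overhang_with_unique (overhang_ofP hx).
Qed.
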